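(* Let $q\in\mathbb C$ with $|q|>1$, let $t\ge 2$ and let $\zeta\in\mathbb C$ be a primitive $t$-th root of unity. For $g\in\mathbb C(z)$ put $\sigma_q(g)(z)=g(qz)$ and $\sigma_\zeta(g)(z)=g(\zeta z)$. Let $a\in\mathbb C(z)$, $a\neq 0$, be written as $$a=\lambda\, z^T\prod_{k=0}^{t-1}\prod_{d=-N-1}^{N}\prod_{i=1}^{R}\bigl(z-\zeta^k q^d r_i\bigr)^{s_{k,d,i}},$$ where $\lambda,r_1,\dots,r_R\in\mathbb C^*$, $T,N,s_{k,d,i}\in\mathbb Z$, and the $r_i$ are pairwise distinct modulo the subgroup $\zeta^{\mathbb Z}q^{\mathbb Z}$ of $\mathbb C^*$. Put $a_{i,k}=\sum_{d=-N-1}^{N}s_{k,d,i}$, $d_{k,i}=\sum_{j=0}^{t-1}\zeta^{kj}a_{i,j}$, and let $D$ be the $t\times R$ matrix whose entry in row $k$ ($k=0,\dots,t-1$) and column $i$ ($i=1,\dots,R$) is $d_{k,i}$; the row with $k=0$ is called the first row. For integers $n_0,\dots,n_{t-1}$ write $\varphi(x)=x^{n_0}(\sigma_\zeta x)^{n_1}\cdots(\sigma_\zeta^{t-1}x)^{n_{t-1}}$. Then: (1) If $T=0$ and either $\lambda^{\mathbb Z}\cap q^{\mathbb Z}\neq\{1\}$ or $\lambda$ is a root of unity, then there exist $0\neq b\in\mathbb C(z)$ and integers $n_0,\dots,n_{t-1}$, not all zero, with $\varphi(a)=\sigma_q(b)/b$ if and only if $D$ has a zero row. (2) If either $T\neq0$,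 or ($\lambda^{\mathbb Z}\cap q^{\mathbb Z}=\{1\}$ and $\lambda$ is not a root of unity), then there exist $0\neq b\in\mathbb C(z)$ and integers $n_0,\dots,n_{t-1}$, not all zero, with $\varphi(a)=\sigma_q(b)/b$ if and only if $D$ has a zero row other than the first row.
   Context: Here $\varphi(a)$ means $a^{n_0}\sigma_\zeta(a)^{n_1}\cdots\sigma_\zeta^{t-1}(a)^{n_{t-1}}\in\mathbb C(z)$. *)

(* Defs.v *)
From HB Require Import structures.
From mathcomp Require Import all_boot all_order all_algebra.
From mathcomp Require Import complex reals.
From mathcomp Require Import fraction.
Set Implicit Arguments. Unset Strict Implicit. Unset Printing Implicit Defensive.
Import Order.TTheory GRing.Theory Num.Theory.
Local Open Scope ring_scope.

Notation ratfun C := {fraction {poly C}}.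

Notation tof := (@FracField.tofrac _).

Definition zvar (C : fieldType) : ratfun C := tof 'X.

Definition sigma (C : fieldType) (c : C) (g : ratfun C) : ratfun C :=
  tof ((\n_(repr g)) \Po (c *: 'X)) / tof ((\d_(repr g)) \Po (c *: 'X)).

Definition phi (C : fieldType) (t : nat) (zeta : C) (n : 'I_t -> int) (a : ratfun C)
  : ratfun C :=
  \prod_(j < t) (iter j (sigma zeta) a) ^ (n j).

(* Explicit product form:
   lambda z^T prod_{k<t} prod_{d=-N-1}^{N} prod_{i<R} (z - zeta^k q^d r_i)^{s k d i};
   the index j < 2N+2 stands for d = j - N - 1. *)
Definition dshift (N : nat) (j : nat) : int := j%:Z - (N.+1)%:Z.

Definition prod_form (C : fieldType) (t N Rn : nat) (zeta q lambda : C) (T : int)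
  (r : 'I_Rn -> C) (s : 'I_t -> int -> 'I_Rn -> int) : ratfun C :=
  tof (lambda%:P) * zvar C ^ T *
  \prod_(k < t) \prod_(j < (N + N).+2) \prod_(i < Rn)
     (zvar C - tof ((zeta ^+ k * q ^ (dshift N j) * r i)%:P)) ^ (s k (dshift N j) i).

Definition aik (t N Rn : nat) (s : 'I_t -> int -> 'I_Rn -> int) (i : 'I_Rn) (k : 'I_t)
  : int := \sum_(j < (N + N).+2) s k (dshift N j) i.

Definition Dmat (C : fieldType) (t N Rn : nat) (zeta : C) (s : 'I_t -> int -> 'I_Rn -> int)
  : 'M[C]_(t, Rn) :=
  \matrix_(k < t, i < Rn) \sum_(j < t) zeta ^+ (k * j) * (aik N s i j)%:~R.

Definition zero_row (C : fieldType) (m n : nat) (M : 'M[C]_(m, n)) (k : 'I_m) : Prop :=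
  forall i, M k i = 0.

Definition q_solvable (C : fieldType) (t : nat) (zeta q : C) (a : ratfun C) : Prop :=
  exists (b : ratfun C) (n : 'I_t -> int),
    b != 0 /\ (exists j, n j != 0) /\ phi zeta n a = sigma q b / b.

(* Main.v *)
(** Call f and g congruent when f = u * g * sigma_q(b) / b for a nonzero b and a
  constant u with u ^+ t = 1. Factors z - q^d x and z - x are congruent, and
  sigma_zeta (z - x) is congruent to z - zeta^-1 x, so phi(a) is congruent to a
  product of powers of lambda, z and the z - zeta^m r_i, the exponent of the
  latter being the cyclic correlation of n with a_i (cycsum). Conversely,
  summing the orders of vanishing of sigma_q(b) / b along an orbit q^Z c gives
  a telescoping sum, so if phi(a) = sigma_q(b) / b then all these exponents
  vanish; the order at 0 and the leading coefficient bound the exponents of z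
  and lambda. By the discrete Fourier transform, the correlations vanish for
  some nonzero n if and only if D has a zero row, say row k; the sum of the n_j
  is the Fourier coefficient at 0, and it can be taken to be 0 exactly when
  some k > 0 occurs. *)
Require Import Defs.
From HB Require Import structures.
From mathcomp Require Import all_boot all_order all_algebra.
From mathcomp Require Import complex reals.
From mathcomp Require Import fraction ring.
Set Implicit Arguments.
Unset Strict Implicit.
Unset Printing Implicit Defensive.
Import Order.TTheory GRing.Theory Num.Theory.
Local Open Scope ring_scope.

(** * Representatives of fractions *)

Section FractionRepr.
Variable D : idomainType.
Implicit Types (x y : D) (f : {fraction D}).

Lemma frac_reprE f : f = tof \n_(repr f) / tof \d_(repr f).
Proof.
have d0 : tof \d_(repr f) != 0 by rewrite tofrac_eq0 denom_ratioP.
apply: (mulIf d0); rewrite divfK //.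
set r := repr f; rewrite -[f in LHS]reprK -/r.
unlock FracField.tofrac; rewrite -[LHS]FracField.pi_mul.
apply/eqP; rewrite FracField.equivf_def /FracField.mulf.
by rewrite !numden_Ratio ?mulf_neq0 ?oner_neq0 ?denom_ratioP // !mulr1 mulrC.
Qed.

(** [repr] need not return the pair [x], [y] itself, only a proportional one. This cross-multiplied
    identity is what makes notions defined through [repr] independent of the chosen
    representative. *)
Lemma frac_repr_cross x y : y != 0 ->
  \n_(repr (tof x / tof y)) * y = x * \d_(repr (tof x / tof y)).
Proof.
move=> y0; set f := tof x / tof y.
have d0 : tof \d_(repr f) != 0 by rewrite tofrac_eq0 denom_ratioP.
have ty0 : tof y != 0 by rewrite tofrac_eq0.
apply/eqP; rewrite -tofrac_eq !tofracM; apply/eqP.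
by have /eqP := frac_reprE f; rewrite {1}/f eqr_div // => /eqP ->.
Qed.

Variant frac_spec : {fraction D} -> Prop :=
  FracSpec x y of y != 0 : frac_spec (tof x / tof y).

Lemma fracP f : frac_spec f.
Proof. by rewrite [f]frac_reprE; constructor; apply: denom_ratioP. Qed.

Lemma frac_eq0 x y : y != 0 -> (tof x / tof y == 0) = (x == 0).
Proof. by move=> y0; rewrite mulf_eq0 invr_eq0 !tofrac_eq0 (negPf y0) orbF. Qed.

Lemma frac_mul x y x' y' :
  tof x / tof y * (tof x' / tof y') = tof (x * x') / tof (y * y').
Proof. by rewrite !tofracM invfM mulrACA. Qed.

End FractionRepr.

(** * The substitution z -> cz as a field automorphism *)

Section Sigma.
Variable C : fieldType.
Implicit Types (c d : C) (p : {poly C}) (f g : ratfun C).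

Lemma size_scaleX c : c != 0 -> size (c *: 'X) = 2%N.
Proof. by move=> c0; rewrite size_scale // size_polyX. Qed.

Lemma comp_scaleX_eq0 c p : c != 0 -> (p \Po (c *: 'X) == 0) = (p == 0).
Proof. by move=> c0; rewrite comp_poly2_eq0 // size_scaleX. Qed.

(** Substitution is multiplicative on polynomials, so it preserves the cross-multiplied identity,
    and for nonzero [c] it keeps denominators nonzero. *)
Lemma sigma_frac c p p' : c != 0 -> p' != 0 ->
  sigma c (tof p / tof p') = tof (p \Po (c *: 'X)) / tof (p' \Po (c *: 'X)).
Proof.
move=> c0 p'0; rewrite /sigma; apply/eqP.
rewrite eqr_div ?tofrac_eq0 ?comp_scaleX_eq0 ?denom_ratioP //.
by rewrite -!tofracM tofrac_eq -!comp_polyM frac_repr_cross // mulrC.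
Qed.

Lemma sigma_tof c p : c != 0 -> sigma c (tof p) = tof (p \Po (c *: 'X)).
Proof.
move=> c0; rewrite -[tof p]divr1 -(tofrac1 {poly C}) sigma_frac ?oner_neq0 //.
by rewrite comp_polyC tofrac1 divr1.
Qed.

Lemma sigmaM c f g : c != 0 -> sigma c (f * g) = sigma c f * sigma c g.
Proof.
move=> c0; case: (fracP f) => a b b0; case: (fracP g) => a' b' b'0.
by rewrite frac_mul !sigma_frac ?mulf_neq0 // frac_mul !comp_polyM.
Qed.

Lemma sigma_eq0 c f : c != 0 -> (sigma c f == 0) = (f == 0).
Proof.
move=> c0; case: (fracP f) => a b b0.
by rewrite (sigma_frac _ c0 b0) (frac_eq0 _ b0) frac_eq0 !comp_scaleX_eq0.
Qed.

Lemma sigma_comp c d f : c != 0 -> d != 0 ->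
  sigma c (sigma d f) = sigma (c * d) f.
Proof.
move=> c0 d0; case: (fracP f) => a b b0.
rewrite (sigma_frac _ d0 b0) (sigma_frac _ (mulf_neq0 c0 d0) b0).
rewrite sigma_frac ?comp_scaleX_eq0 //.
by rewrite -!comp_polyA !comp_polyZ comp_polyX scalerA (mulrC d).
Qed.

Lemma sigma1 c : c != 0 -> sigma c 1 = 1.
Proof. by move=> c0; rewrite -(tofrac1 {poly C}) sigma_tof // comp_polyC. Qed.

Lemma sigmaV c f : c != 0 -> sigma c f^-1 = (sigma c f)^-1.
Proof.
move=> c0; have [->|f0] := eqVneq f 0.
  have /eqP -> : sigma c (0 : ratfun C) == 0 by rewrite sigma_eq0.
  by rewrite invr0; apply/eqP; rewrite sigma_eq0.
have s0 : sigma c f != 0 by rewrite sigma_eq0.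
apply: (mulIf s0).
by rewrite -(sigmaM _ _ c0) (mulVf f0) (mulVf s0) sigma1.
Qed.

Lemma sigmaXz c f (m : int) : c != 0 -> sigma c (f ^ m) = sigma c f ^ m.
Proof.
move=> c0; have sX (n : nat) : sigma c (f ^+ n) = sigma c f ^+ n.
  by elim: n => [|n IH]; rewrite ?sigma1 // !exprS sigmaM // IH.
by case: m => n; rewrite ?NegzE -?exprnP -?exprnN ?sigmaV // sX.
Qed.

Lemma sigma_prod c (I : Type) (s : seq I) (P : pred I) (F : I -> ratfun C) :
  c != 0 ->
  sigma c (\prod_(i <- s | P i) F i) = \prod_(i <- s | P i) sigma c (F i).
Proof.
by move=> c0; apply: (big_morph (sigma c)) => [f g|]; [apply: sigmaM | apply: sigma1].
Qed.

Lemma sigma_const c d : c != 0 -> sigma c (tof d%:P) = tof d%:P.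
Proof. by move=> c0; rewrite sigma_tof // comp_polyC. Qed.

Lemma sigma_zvar c : c != 0 -> sigma c (zvar C) = tof c%:P * zvar C.
Proof. by move=> c0; rewrite sigma_tof // comp_polyX -mul_polyC tofracM. Qed.

Definition linfac c : ratfun C := zvar C - tof c%:P.

Lemma linfacE c : linfac c = tof ('X - c%:P).
Proof. by rewrite tofracB. Qed.

Lemma linfac_neq0 c : linfac c != 0.
Proof. by rewrite linfacE tofrac_eq0 polyXsubC_eq0. Qed.

Lemma zvar_neq0 : zvar C != 0.
Proof. by rewrite tofrac_eq0 polyX_eq0. Qed.

Lemma tofC_neq0 c : (tof c%:P != 0 :> ratfun C) = (c != 0).
Proof. by rewrite tofrac_eq0 polyC_eq0. Qed.

Lemma sigma_linfac c d : c != 0 -> sigma c (linfac (c * d)) = tof c%:P * linfac d.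
Proof.
move=> c0; rewrite !linfacE sigma_tof // comp_polyB comp_polyX comp_polyC.
by rewrite -tofracM mulrBr mul_polyC polyCM.
Qed.

End Sigma.

(** * Orders of vanishing and leading coefficients *)

Section Order.
Variable C : fieldType.
Implicit Types (c d x : C) (p : {poly C}) (f g : ratfun C).

(** Substituting cz for z turns the factor z - cx into c(z - x), which gives one inequality; the
    other is the same inequality for the inverse substitution. *)
Lemma mup_comp_scaleX c x p : c != 0 -> p != 0 ->
  mup x (p \Po (c *: 'X)) = mup (c * x) p.
Proof.
suff le (c' x' : C) p' : c' != 0 -> p' != 0 ->
    (mup (c' * x') p' <= mup x' (p' \Po (c' *: 'X)))%N.
  move=> c0 p0; apply/eqP; rewrite eqn_leq le // andbT.
  have := @le c^-1 (c * x) (p \Po (c *: 'X)).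
  rewrite mulKf // comp_scaleX_eq0 // invr_neq0 // -comp_polyA comp_polyZ.
  by rewrite comp_polyX scalerA mulfV // scale1r comp_polyXr; apply.
move=> c0 p0; rewrite mup_geq ?comp_scaleX_eq0 //.
have: (('X - (c' * x')%:P) ^+ mup (c' * x') p' %| p')%R by rewrite -mup_geq.
case/dvdpP => u {2}->; rewrite comp_polyM; apply: dvdp_mull.
rewrite rmorphXn /=; apply: dvdp_exp2r.
rewrite comp_polyB comp_polyX comp_polyC polyCM -mul_polyC -mulrBr.
by rewrite dvdp_mull.
Qed.

(** The order of vanishing of [f] at [x], negative at a pole. *)
Definition ford x f : int := (mup x \n_(repr f))%:Z - (mup x \d_(repr f))%:Z.

Lemma ford_frac x p p' : p != 0 -> p' != 0 ->
  ford x (tof p / tof p') = (mup x p)%:Z - (mup x p')%:Z.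
Proof.
move=> p0 p'0; set f := tof p / tof p'.
have d0 : \d_(repr f) != 0 by apply: denom_ratioP.
have n0 : \n_(repr f) != 0.
  by rewrite -(frac_eq0 _ d0) -frac_reprE frac_eq0.
have /(congr1 (mup x)) := frac_repr_cross p p'0.
rewrite -/f !mupM // => /(congr1 Posz); rewrite !PoszD /ford => e.
by apply/eqP; rewrite subr_eq addrAC eq_sym subr_eq e.
Qed.

Lemma ford_tof x p : p != 0 -> ford x (tof p) = mup x p.
Proof.
move=> p0; rewrite -[tof p]divr1 -(tofrac1 {poly C}) ford_frac ?oner_neq0 //.
by rewrite [mup x 1]mupNroot ?subr0 // root1.
Qed.

Lemma fordM x f g : f != 0 -> g != 0 -> ford x (f * g) = ford x f + ford x g.
Proof.
case: (fracP f) => a b b0; case: (fracP g) => a' b' b'0.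
rewrite (frac_eq0 _ b0) (frac_eq0 _ b'0) => a0 a'0.
rewrite frac_mul !ford_frac ?mulf_neq0 //.
by rewrite !mupM // !PoszD opprD addrACA.
Qed.

Lemma ford1 x : ford x 1 = 0.
Proof. by rewrite -(tofrac1 {poly C}) ford_tof ?oner_neq0 // mupNroot ?root1. Qed.

Lemma fordV x f : f != 0 -> ford x f^-1 = - ford x f.
Proof.
move=> f0; apply/eqP; rewrite -addr_eq0 -fordM ?invr_neq0 // mulVf //.
by rewrite ford1.
Qed.

Lemma fordXz x f (m : int) : f != 0 -> ford x (f ^ m) = m * ford x f.
Proof.
move=> f0; have oX (n : nat) : ford x (f ^+ n) = n%:Z * ford x f.
  elim: n => [|n IH]; first by rewrite ford1 mul0r.
  by rewrite exprS fordM ?expf_neq0 // IH intS mulrDl mul1r.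
case: m => n; first by rewrite -exprnP oX.
by rewrite NegzE -exprnN fordV ?expf_neq0 // oX mulNr.
Qed.

Lemma ford_prod x (I : Type) (s : seq I) (F : I -> ratfun C) :
  (forall i, F i != 0) ->
  ford x (\prod_(i <- s) F i) = \sum_(i <- s) ford x (F i).
Proof.
move=> F0; elim: s => [|i s IH]; first by rewrite !big_nil ford1.
rewrite !big_cons fordM ?IH //.
by elim/big_ind: _ => [|f g|]; [apply: oner_neq0 | apply: mulf_neq0 |].
Qed.

Lemma ford_sigma c x f : c != 0 -> f != 0 -> ford x (sigma c f) = ford (c * x) f.
Proof.
move=> c0; case: (fracP f) => a b b0; rewrite frac_eq0 // => a0.
by rewrite sigma_frac // !ford_frac ?comp_scaleX_eq0 // !mup_comp_scaleX.
Qed.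

Lemma ford_linfac x c : ford x (linfac c) = (x == c)%:R.
Proof.
rewrite linfacE ford_tof ?polyXsubC_eq0 // (mup_XsubCX 1) eq_sym.
by case: eqP.
Qed.

Lemma ford_const x c : c != 0 -> ford x (tof c%:P) = 0.
Proof. by move=> c0; rewrite ford_tof ?polyC_eq0 // mupNroot // rootC. Qed.

Lemma ford_zvar x : ford x (zvar C) = (x == 0)%:R.
Proof. by rewrite -[zvar C]subr0 -(tofrac0 {poly C}) -polyC0 ford_linfac. Qed.

(** Zeros and poles of a / b are roots of ab, and a nonzero polynomial cannot vanish at as many
    distinct points as its size. *)
Lemma ford_eq0_exists (y : nat -> C) f : injective y -> f != 0 ->
  exists m, ford (y m) f = 0.
Proof.
move=> y_inj; case: (fracP f) => a b b0; rewrite frac_eq0 // => a0.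
have ab0 : a * b != 0 by rewrite mulf_neq0.
have: ~~ all (root (a * b)) (map y (iota 0 (size (a * b)))).
  apply/negP => /(max_poly_roots ab0).
  by rewrite map_inj_uniq // iota_uniq size_map size_iota ltnn => /(_ isT).
case/allPn => _ /mapP[m _ ->]; rewrite rootM negb_or => /andP[ra rb].
by exists m; rewrite ford_frac // !mupNroot.
Qed.

(** The leading coefficient of the expansion of [f] at infinity. *)
Definition flead f : C := lead_coef \n_(repr f) / lead_coef \d_(repr f).

Lemma flead_frac p p' : p' != 0 ->
  flead (tof p / tof p') = lead_coef p / lead_coef p'.
Proof.
move=> p'0; apply/eqP; rewrite eqr_div ?lead_coef_eq0 ?denom_ratioP //.
by rewrite -!lead_coefM frac_repr_cross.
Qed.

Lemma flead_tof p : flead (tof p) = lead_coef p.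
Proof.
rewrite -[tof p]divr1 -(tofrac1 {poly C}) flead_frac ?oner_neq0 //.
by rewrite lead_coef1 divr1.
Qed.

Lemma fleadM : {morph flead : f g / f * g}.
Proof.
move=> f g; case: (fracP f) => a b b0; case: (fracP g) => a' b' b'0.
rewrite frac_mul !flead_frac ?mulf_neq0 // !lead_coefM invfM.
by rewrite mulrACA.
Qed.

Lemma flead1 : flead 1 = 1.
Proof. by rewrite -(tofrac1 {poly C}) flead_tof lead_coef1. Qed.

Lemma flead_neq0 f : f != 0 -> flead f != 0.
Proof.
case: (fracP f) => a b b0; rewrite frac_eq0 // => a0.
by rewrite flead_frac // mulf_neq0 ?invr_eq0 ?lead_coef_eq0.
Qed.

Lemma flead_const c : flead (tof c%:P) = c.
Proof. by rewrite flead_tof lead_coefC. Qed.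

(** The exponent is the degree of [f], numerator minus denominator; only its existence matters
    later. *)
Lemma flead_sigma c f : c != 0 -> f != 0 ->
  exists m : int, flead (sigma c f) = c ^ m * flead f.
Proof.
move=> c0; case: (fracP f) => a b b0; rewrite frac_eq0 // => a0.
exists ((size a).-1%:Z - (size b).-1%:Z).
rewrite sigma_frac // !flead_frac ?comp_scaleX_eq0 //.
have lc (p : {poly C}) : lead_coef (p \Po (c *: 'X)) = lead_coef p * c ^+ (size p).-1.
  rewrite lead_coef_comp ?size_scaleX // lead_coefZ lead_coefX mulr1.
  by [].
rewrite !lc expfzDr // -exprnP -exprnN invfM; ring.
Qed.

Lemma fleadV f : flead f^-1 = (flead f)^-1.
Proof.
have [->|f0] := eqVneq f 0.
  by rewrite invr0 -(tofrac0 {poly C}) flead_tof lead_coef0 invr0.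
apply: (mulIf (flead_neq0 f0)).
by rewrite -fleadM !mulVf ?flead1 ?flead_neq0.
Qed.

Lemma fleadXz f (m : int) : flead (f ^ m) = flead f ^ m.
Proof.
have lX (n : nat) : flead (f ^+ n) = flead f ^+ n.
  by elim: n => [|n IH]; rewrite ?flead1 // !exprS fleadM IH.
by case: m => n; rewrite ?NegzE -?exprnP -?exprnN ?fleadV lX.
Qed.

End Order.

(** * Congruence modulo q-coboundaries *)

Section Coboundary.
Variables (C : fieldType) (t : nat) (zeta q : C).
Hypotheses (q0 : q != 0) (t_gt0 : (0 < t)%N) (zeta_t : zeta ^+ t = 1).
Implicit Types (c u x : C) (f g h b : ratfun C).

Lemma root1_neq0 u : u ^+ t = 1 -> u != 0.
Proof.
move=> ut; apply/eqP => u0; move: ut (oner_neq0 C).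
by rewrite u0 expr0n eqn0Ngt t_gt0 => <-; rewrite eqxx.
Qed.

Let zeta0 : zeta != 0 := root1_neq0 zeta_t.

(* Constant factors u with u ^+ t = 1 are allowed since they disappear after
  raising to the power t. *)
Definition qcob f := exists2 b, b != 0 &
  exists2 u, u ^+ t = 1 & f = tof u%:P * (sigma q b / b).

Lemma qcob_neq0 f : qcob f -> f != 0.
Proof.
move=> [b b0 [u ut ->]].
apply: mulf_neq0; first by rewrite tofC_neq0 root1_neq0.
by apply: mulf_neq0; rewrite ?invr_eq0 ?sigma_eq0.
Qed.

Lemma qcob_root1 u : u ^+ t = 1 -> qcob (tof u%:P).
Proof.
move=> ut; exists 1; first exact: oner_neq0.
by exists u; rewrite // sigma1 // divr1 mulr1.
Qed.

Lemma qcob_sigma b : b != 0 -> qcob (sigma q b / b).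
Proof.
move=> b0; exists b => //; exists 1; first exact: expr1n.
by rewrite tofrac1 mul1r.
Qed.

Lemma qcobM f g : qcob f -> qcob g -> qcob (f * g).
Proof.
move=> [b b0 [u ut ->]] [c c0 [v vt ->]].
exists (b * c); first exact: (mulf_neq0 b0 c0).
exists (u * v); first by rewrite exprMn ut vt mulr1.
by rewrite polyCM tofracM (sigmaM _ _ q0) invfM mulrACA; congr (_ * _); rewrite mulrACA.
Qed.

Lemma qcobV f : qcob f -> qcob f^-1.
Proof.
move=> [b b0 [u ut ->]]; exists b^-1; first by rewrite invr_eq0.
have u0 := root1_neq0 ut.
exists u^-1; first by rewrite exprVn ut invr1.
rewrite invfM (sigmaV _ q0) invfM; congr (_ * _).
have tu0 : tof u%:P != 0 by rewrite tofC_neq0.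
by apply: (mulIf tu0); rewrite (mulVf tu0) -tofracM -polyCM mulVf.
Qed.

Lemma qcob1 : qcob 1.
Proof. by rewrite -(tofrac1 {poly C}); apply/qcob_root1/expr1n. Qed.

Lemma qcobXz f (m : int) : qcob f -> qcob (f ^ m).
Proof.
move=> Hf; have HX (n : nat) : qcob (f ^+ n).
  by elim: n => [|n IH]; [apply: qcob1 | rewrite exprS; apply: qcobM].
by case: m => n; rewrite ?NegzE -?exprnP -?exprnN; [|apply: qcobV]; apply: HX.
Qed.

Lemma qcob_sigma_comm c f : c != 0 -> qcob f -> qcob (sigma c f).
Proof.
move=> c0 [b b0 [u ut ->]]; exists (sigma c b); first by rewrite sigma_eq0.
exists u => //; rewrite (sigmaM _ _ c0) (sigmaM _ _ c0) (sigmaV _ c0).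
by rewrite (sigma_const _ c0) !sigma_comp // (mulrC c).
Qed.

(** The witness is b = z. *)
Lemma qcob_q : qcob (tof q%:P).
Proof.
have := qcob_sigma (zvar_neq0 C).
by rewrite (sigma_zvar q0) (mulfK (zvar_neq0 C)).
Qed.

Definition cong f g := exists2 h, qcob h & f = g * h.

Lemma cong_refl f : cong f f.
Proof. by exists 1; [apply: qcob1 | rewrite mulr1]. Qed.

Lemma cong_trans g f h : cong f g -> cong g h -> cong f h.
Proof.
move=> [a Ha ->] [b Hb ->]; exists (b * a); first exact: qcobM.
by rewrite mulrA.
Qed.

Lemma cong_sym f g : cong f g -> cong g f.
Proof.
move=> [a Ha ->]; exists a^-1; first exact: qcobV.
by rewrite (mulfK (qcob_neq0 Ha)).
Qed.

Lemma congM f g f' g' : cong f g -> cong f' g' -> cong (f * f') (g * g').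
Proof.
move=> [a Ha ->] [b Hb ->]; exists (a * b); first exact: qcobM.
by rewrite mulrACA.
Qed.

Lemma congXz f g (m : int) : cong f g -> cong (f ^ m) (g ^ m).
Proof.
move=> [a Ha ->]; exists (a ^ m); first exact: qcobXz.
by rewrite expfzMl.
Qed.

Lemma cong_prod (I : Type) (s : seq I) (F G : I -> ratfun C) :
  (forall i, cong (F i) (G i)) ->
  cong (\prod_(i <- s) F i) (\prod_(i <- s) G i).
Proof.
move=> FG; elim/big_rec2: _ => [|i f g _]; first exact: cong_refl.
exact: congM.
Qed.

Lemma cong_sigma c f g : c != 0 -> cong f g -> cong (sigma c f) (sigma c g).
Proof.
move=> c0 [a Ha ->]; exists (sigma c a); first exact: qcob_sigma_comm.
by rewrite (sigmaM _ _ c0).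
Qed.

(** With b = z - qy one has sigma_q(b) = q(z - y), so (z - y) / (z - qy) is sigma_q(b) / b divided
    by q, and q is itself a coboundary. Induction on [d] in both directions does the rest. *)
Lemma cong_linfac_q (d : int) x : cong (linfac (q ^ d * x)) (linfac x).
Proof.
have step y : cong (linfac (q * y)) (linfac y).
  apply: cong_sym; set b := linfac (q * y).
  have tq0 : tof q%:P != 0 by rewrite tofC_neq0.
  exists ((tof q%:P)^-1 * (sigma q b / b)).
    exact: qcobM (qcobV qcob_q) (qcob_sigma (linfac_neq0 _)).
  rewrite (sigma_linfac _ q0) -[tof _ * _ / _]mulrA (mulKf tq0).
  by rewrite mulrCA (divff (linfac_neq0 _)) mulr1.
elim/int_rec: d => [|n IH|n IH]; first by rewrite expr0z mul1r; apply: cong_refl.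
  apply: cong_trans IH; rewrite intS expfzDr // expr1z -mulrA; exact: step.
apply: cong_trans IH; apply: cong_sym.
have -> : q ^ (- n%:Z) * x = q * (q ^ (- n.+1%:Z) * x).
  rewrite mulrA; congr (_ * _).
  by rewrite -[X in X * _]expr1z -expfzDr // intS opprD addNKr.
exact: step.
Qed.

(** The substitution leaves a constant factor [zeta], which [qcob] absorbs as a t-th root of
    unity. *)
Lemma cong_sigma_linfac x : cong (sigma zeta (linfac x)) (linfac (zeta^-1 * x)).
Proof.
rewrite -{1}[x](mulVKf zeta0) (sigma_linfac _ zeta0).
by exists (tof zeta%:P); [apply: qcob_root1 | rewrite mulrC].
Qed.

Lemma cong_iter_sigma f (E : nat -> ratfun C) (j : nat) :
  cong f (E 0%N) -> (forall j, cong (sigma zeta (E j)) (E j.+1)) ->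
  cong (iter j (sigma zeta) f) (E j).
Proof.
move=> f0 step; elim: j => [//|j IH]; rewrite iterS.
exact: cong_trans (cong_sigma zeta0 IH) (step j).
Qed.

(** * Normal form of the iterated rotations of a *)

Section ProductForm.
Variables (N Rn : nat) (lambda : C) (T : int) (r : 'I_Rn -> C).
Variable s : 'I_t -> int -> 'I_Rn -> int.
Hypothesis lambda0 : lambda != 0.

(** The representative of the class of sigma_zeta^j(a) in which the powers of q have been removed
    from the roots. *)
Definition rotated_form (j : nat) : ratfun C :=
  tof lambda%:P * zvar C ^ T *
  \prod_(i < Rn) \prod_(k < t)
    linfac (zeta ^- j * (zeta ^+ k * r i)) ^ aik N s i k.

(** Once q^d is dropped from the roots, the factors for the different d coincide and their exponents
    add up to [aik]. *)
Lemma cong_prod_form : cong (prod_form N zeta q lambda T r s) (rotated_form 0).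
Proof.
apply: congM; first exact: cong_refl.
rewrite [X in cong _ X]exchange_big; apply: cong_prod => k.
rewrite exchange_big; apply: cong_prod => i.
rewrite expr0 invr1 mul1r /aik.
have lin0 := linfac_neq0 (zeta ^+ k * r i).
rewrite (big_morph _ (fun m n => expfzDr m n lin0) (expr0z _)).
apply: cong_prod => j; apply: congXz.
by rewrite -/(linfac _) mulrAC mulrC; apply: cong_linfac_q.
Qed.

Lemma cong_sigma_rotated_form j :
  cong (sigma zeta (rotated_form j)) (rotated_form j.+1).
Proof.
rewrite (sigmaM _ _ zeta0) (sigmaM _ _ zeta0) (sigma_const _ zeta0) (sigmaXz _ _ zeta0).
apply: congM.
  apply: congM; first exact: cong_refl.
  apply: congXz; rewrite (sigma_zvar zeta0).
  by exists (tof zeta%:P); [apply: qcob_root1 | rewrite mulrC].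
rewrite (sigma_prod _ _ _ zeta0); apply: cong_prod => i.
rewrite (sigma_prod _ _ _ zeta0); apply: cong_prod => k.
rewrite (sigmaXz _ _ zeta0); apply: congXz.
rewrite exprS invfM -mulrA; exact: cong_sigma_linfac.
Qed.

Lemma rotated_form_neq0 j : rotated_form j != 0.
Proof.
rewrite /rotated_form; apply: mulf_neq0.
  by apply: mulf_neq0; rewrite ?tofC_neq0 // expfz_neq0 // zvar_neq0.
apply/prodf_neq0 => i _; apply/prodf_neq0 => k _.
exact/expfz_neq0/linfac_neq0.
Qed.

Lemma cong_phi (n : 'I_t -> int) :
  cong (phi zeta n (prod_form N zeta q lambda T r s))
       (\prod_(j < t) rotated_form j ^ n j).
Proof.
apply: cong_prod => j; apply: congXz; apply: cong_iter_sigma.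
  exact: cong_prod_form.
exact: cong_sigma_rotated_form.
Qed.

End ProductForm.

End Coboundary.

(** * Cyclic correlation and the discrete Fourier transform *)

Section CyclicConvolution.
Variables (t : nat) (C : fieldType) (zeta : C).
Hypothesis zeta_prim : t.-primitive_root zeta.
Implicit Types a n : 'I_t -> int.

Let t_gt0 : (0 < t)%N := prim_order_gt0 zeta_prim.
Let zeta0 : zeta != 0 := root1_neq0 t_gt0 (prim_expr_order zeta_prim).

(* Exponents of zeta stand for indices modulo t: the sum is over all j, k with
  k = m + j mod t. *)
Definition cycsum a n (m : nat) : int :=
  \sum_(j < t) \sum_(k < t) (zeta ^+ (m + j) == zeta ^+ k)%:R * (a k * n j).

(** Here [m0] is k - j mod t. The lemma collapses a sum or product over [m] containing the indicator
    to its single term at [m0]. *)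
Lemma shift_index (j k : nat) : exists2 m0 : 'I_t, zeta ^+ m0 = zeta ^- j * zeta ^+ k &
  forall m : 'I_t, (zeta ^+ (m + j) == zeta ^+ k) = (m == m0).
Proof.
have /(prim_rootP zeta_prim)[m0 e] : (zeta ^- j * zeta ^+ k) ^+ t = 1.
  rewrite exprMn exprVn !(exprAC _ _ t) (prim_expr_order zeta_prim) !expr1n.
  by rewrite invr1 mulr1.
exists m0 => // m.
have zj0 : zeta ^+ j != 0 by rewrite expf_neq0.
have -> : zeta ^+ k = zeta ^+ m0 * zeta ^+ j by rewrite -e mulrC mulVKf.
rewrite exprD (inj_eq (mulIf zj0)) (eq_prim_root_expr zeta_prim).
by rewrite !modn_small ?ltn_ord.
Qed.

(** Correlation theorem: the Fourier coefficient of the correlation at [l] is that of [a] at [l]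
    times that of [n] at -l. *)
Lemma dft_cycsum a n (l : nat) : (forall m : 'I_t, cycsum a n m = 0) ->
  (\sum_(k < t) zeta ^+ (l * k) * (a k)%:~R) *
  (\sum_(j < t) (n j)%:~R * (zeta ^- l) ^+ j) = 0.
Proof.
move=> cyc0; rewrite mulr_sumr.
transitivity (\sum_(m < t) zeta ^+ (l * m) * (cycsum a n m)%:~R); last first.
  by apply: big1 => m _; rewrite cyc0 mulr0.
under [RHS]eq_bigr => m _ do rewrite /cycsum rmorph_sum mulr_sumr.
rewrite [RHS]exchange_big; apply: eq_bigr => j _.
under [RHS]eq_bigr => m _ do rewrite rmorph_sum mulr_sumr.
rewrite [RHS]exchange_big mulr_suml; apply: eq_bigr => k _.
have [m0 e eqm] := shift_index j k.
under [RHS]eq_bigr => m _ do rewrite eqm.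
rewrite (bigD1 m0) //= eqxx mul1r big1 => [|m /negPf->]; last first.
  by rewrite mul0r mulr0.
rewrite addr0 intrM (mulnC l m0) (exprM zeta m0) e exprMn !exprVn -!exprM.
by rewrite (mulnC k) (mulnC j); ring.
Qed.

(** The polynomial with coefficients n_j has size at most t but vanishes at the t distinct points
    zeta^(-l), so it is zero. *)
Lemma dft_inj n :
  (forall l : 'I_t, \sum_(j < t) (n j)%:~R * (zeta ^- l) ^+ j = 0 :> C) ->
  forall j, (n j)%:~R = 0 :> C.
Proof.
(* [c] extends [n] from ordinals to naturals; its default 0 is never read below t. *)
move=> n0 j; pose c i : C := if insub i is Some i' then (n i')%:~R else 0.
have cE (i : 'I_t) : c i = (n i)%:~R by rewrite /c valK.
pose p := \poly_(i < t) c i.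
suff p0 : p = 0 by rewrite -cE -[RHS](coef0 _ j) -p0 coef_poly ltn_ord.
apply/eqP; apply: contraTT (size_poly t _ : (size p <= t)%N) => p0.
rewrite -ltnNge.
have -> : t = size [seq zeta ^- (l : 'I_t) | l <- enum 'I_t].
  by rewrite size_map size_enum_ord.
apply: (max_poly_roots p0).
  apply/allP => _ /mapP[l _ ->]; apply/eqP; rewrite horner_poly -[RHS](n0 l).
  by apply: eq_bigr => i _; rewrite cE.
rewrite map_inj_uniq ?enum_uniq // => l l' /invr_inj /eqP.
by rewrite (eq_prim_root_expr zeta_prim) !modn_small ?ltn_ord // => /eqP/val_inj.
Qed.

(** A cyclic shift multiplies the Fourier coefficient by a power of [zeta]. Hence a vanishing
    coefficient of [a] at [l] makes zeta^(lj) a solution of all the correlation equations. *)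
Lemma dft_shift a (l m : nat) :
  \sum_(j < t) zeta ^+ (l * j) *
     (\sum_(k < t) (zeta ^+ (m + j) == zeta ^+ k)%:R * a k)%:~R
  = zeta ^- (l * m) * (\sum_(k < t) zeta ^+ (l * k) * (a k)%:~R) :> C.
Proof.
rewrite mulr_sumr.
under [LHS]eq_bigr => j _ do rewrite rmorph_sum mulr_sumr.
rewrite [LHS]exchange_big; apply: eq_bigr => k _.
have [j0 e eqj] := shift_index m k.
under [LHS]eq_bigr => j _ do rewrite addnC eqj.
rewrite (bigD1 j0) //= eqxx mul1r big1 => [|j /negPf->]; last first.
  by rewrite mul0r mulr0.
rewrite addr0 (mulnC l j0) (exprM zeta j0) e exprMn exprVn -!exprM (mulnC k) (mulnC m).
by rewrite mulrA.
Qed.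

End CyclicConvolution.

(** Freeness of the rows of a rational matrix does not change under extension to [C], so a nonzero
    solution in [C] gives a nonzero rational one, whose denominators are then cleared. *)
Lemma int_kernel (C : numFieldType) (t : nat) (I : finType)
    (A : 'I_t -> I -> int) (x : 'I_t -> C) :
  (exists j, x j != 0) -> (forall i, \sum_(j < t) x j * (A j i)%:~R = 0) ->
  exists2 n : 'I_t -> int, exists j, n j != 0 &
    forall i, \sum_(j < t) n j * A j i = 0.
Proof.
move=> [j0 xj0] x_ker.
pose M : 'M[rat]_(t, #|I|) := \matrix_(j, i) (A j (enum_val i))%:~R.
have : ~~ row_free M.
  rewrite -(row_free_map (@ratr C)); apply/negP => /row_free_inj M_inj.
  have /M_inj/rowP/(_ j0) :
      (\row_j x j) *m map_mx (@ratr C) M = 0 *m map_mx (@ratr C) M.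
    apply/rowP => i; rewrite mul0mx !mxE -[RHS](x_ker (enum_val i)).
    by apply: eq_bigr => j _; rewrite !mxE ratr_int.
  by rewrite !mxE; apply/eqP.
rewrite -kermx_eq0 => /rowV0Pn[v /sub_kermxP vM v0].
pose d := \prod_(j < t) denq (v ord0 j).
have d0 : d != 0 by apply/prodf_neq0 => j _; apply: denq_neq0.
(* This is v_j times the common denominator [d], with the denominator of v_j cancelled so as to stay
   in the integers. *)
pose n j := numq (v ord0 j) * \prod_(i < t | i != j) denq (v ord0 i).
have nE j : (n j)%:~R = v ord0 j * d%:~R :> rat.
  rewrite /n /d [in RHS](bigD1 j) //= !intrM mulrA; congr (_ * _).
  exact: numqE.
exists n => [|i].
  have /rV0Pn[j vj] := v0; exists j.
  by rewrite -(intr_eq0 rat) nE mulf_neq0 // intr_eq0.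
apply/eqP; rewrite -(intr_eq0 rat) rmorph_sum /=; apply/eqP.
have /rowP/(_ (enum_rank i)) := vM; rewrite !mxE => e.
rewrite -[RHS](mulr0 d%:~R) -[X in _ = _ * X]e mulr_sumr.
by apply: eq_bigr => j _; rewrite intrM nE !mxE enum_rankK mulrAC mulrC.
Qed.

(** * Necessary conditions from orders and leading coefficients *)

Section Criterion.
Variables (C : fieldType) (t : nat) (zeta q : C).
Variables (N Rn : nat) (lambda : C) (T : int) (r : 'I_Rn -> C).
Variable s : 'I_t -> int -> 'I_Rn -> int.
Hypotheses (zeta_prim : t.-primitive_root zeta) (q0 : q != 0).
Hypothesis q_free : forall m : int, q ^ m = 1 -> m = 0.
Hypotheses (lambda0 : lambda != 0) (r0 : forall i, r i != 0).
Hypothesis r_indep : forall i j : 'I_Rn, i != j ->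
  ~ exists m n : int, r i = zeta ^ m * q ^ n * r j.

Let t_gt0 : (0 < t)%N := prim_order_gt0 zeta_prim.
Let zeta_t : zeta ^+ t = 1 := prim_expr_order zeta_prim.
Let zeta0 : zeta != 0 := root1_neq0 t_gt0 zeta_t.

Local Notation form := (rotated_form zeta N lambda T r s).
Local Notation cyc n i := (cycsum zeta (aik N s i) n).

Let form_neq0 j : form j != 0 := rotated_form_neq0 zeta N T r s lambda0 j.

Lemma ford_form c (j : nat) : ford c (form j) =
  T * (c == 0)%:R +
  \sum_(i < Rn) \sum_(k < t) aik N s i k * (c == zeta ^- j * (zeta ^+ k * r i))%:R.
Proof.
have lin0 (i : 'I_Rn) (k : 'I_t) :
    linfac (zeta ^- j * (zeta ^+ k * r i)) ^ aik N s i k != 0.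
  exact/expfz_neq0/linfac_neq0.
have prod0 (i : 'I_Rn) :
    \prod_(k < t) linfac (zeta ^- j * (zeta ^+ k * r i)) ^ aik N s i k != 0.
  by apply/prodf_neq0 => k _; apply: lin0.
rewrite /rotated_form fordM; last first.
- by apply/prodf_neq0 => i _; apply: prod0.
- by apply: mulf_neq0; rewrite ?tofC_neq0 // expfz_neq0 // zvar_neq0.
rewrite fordM ?tofC_neq0 ?expfz_neq0 ?zvar_neq0 // (ford_const _ lambda0) add0r.
rewrite (fordXz _ _ (zvar_neq0 C)) ford_zvar; congr (_ + _).
rewrite (ford_prod _ _ prod0); apply: eq_bigr => i _.
rewrite (ford_prod _ _ (lin0 i)); apply: eq_bigr => k _.
by rewrite (fordXz _ _ (linfac_neq0 _)) ford_linfac.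
Qed.

Lemma ford_prod_form c (n : 'I_t -> int) :
  ford c (\prod_(j < t) form j ^ n j) = \sum_(j < t) n j * ford c (form j).
Proof.
rewrite ford_prod; first by apply: eq_bigr => j _; rewrite (fordXz _ _ (form_neq0 j)).
by move=> j; apply/expfz_neq0/form_neq0.
Qed.

(** Orders ignore the constant [u] and turn the multiplicative equation into a difference equation
    along q-orbits. *)
Lemma ford_qcob f : qcob t q f -> exists2 b, b != 0 &
  forall c, ford c f = ford (q * c) b - ford c b.
Proof.
move=> [b b0 [u ut ->]]; exists b => // c.
have u0 := root1_neq0 t_gt0 ut.
have sb0 : sigma q b != 0 by rewrite sigma_eq0.
have bV0 : b^-1 != 0 by rewrite (invr_eq0 b) b0.
rewrite (fordM _ _ (mulf_neq0 sb0 bV0)) ?tofC_neq0 // (ford_const _ u0) add0r.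
by rewrite (fordM _ sb0 bV0) (ford_sigma _ q0 b0) (fordV _ b0).
Qed.

(** Used with [m] equal to 1 and -1, to walk along an orbit in either direction without
    repetition. *)
Lemma q_powers_inj c (m : int) : c != 0 -> m != 0 ->
  injective (fun e : nat => q ^ (m * e%:Z) * c).
Proof.
move=> c0 m0 e e' /(mulIf c0) eq_q.
suff : m * (e%:Z - e'%:Z) = 0.
  by move/eqP; rewrite mulf_eq0 (negPf m0) subr_eq0 => /eqP[].
by apply: q_free; rewrite mulrBr expfzDr // eq_q -expfzDr // subrr expr0z.
Qed.

(* The window q^(-A) c, ..., q^(B-1) c is chosen so that b has neither zero nor
  pole at q^(-A) c and q^B c; the sum telescopes. *)
Lemma qcob_window c f : c != 0 -> qcob t q f -> exists A B : nat, (0 < B)%N /\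
  \sum_(e < A + B) ford (q ^ (e%:Z - A%:Z) * c) f = 0.
Proof.
move=> c0 /ford_qcob[b b0 fE].
have [A bA] := ford_eq0_exists (q_powers_inj c0 (isT : -1 != 0 :> int)) b0.
(* The forward walk starts at qc rather than c, so that the window always contains c itself; hence
   [B.+1] below. *)
have qc0 : q * c != 0 by rewrite mulf_neq0.
have [B bB] := ford_eq0_exists (q_powers_inj qc0 (isT : 1 != 0 :> int)) b0.
exists A, B.+1; split=> //.
have step (e : nat) : q * (q ^ (e%:Z - A%:Z) * c) = q ^ (e.+1%:Z - A%:Z) * c.
  by rewrite mulrA intS -[in RHS]addrA (expfzDr 1 _ q0) expr1z.
pose g e := ford (q ^ (e%:Z - A%:Z) * c) b.
transitivity (\sum_(0 <= e < A + B.+1) (g e.+1 - g e)).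
  by rewrite big_mkord; apply: eq_bigr => e _; rewrite fE step.
rewrite telescope_sumr // /g.
have -> : (A + B.+1)%:Z - A%:Z = B%:Z + 1 by rewrite PoszD addrAC subrr add0r -addn1.
rewrite expfzDr // expr1z -mulrA -[B%:Z]mul1r bB.
by rewrite !sub0r -[- A%:Z]mulN1r bA oppr0.
Qed.

(** Different r_i lie in different classes, and within one class only the trivial power of q, at
    position e = A, can be a power of [zeta]. Positivity of [B] puts that position in the window. *)
Lemma window_match (A B : nat) (i i' : 'I_Rn) (j m : nat) (k : 'I_t) : (0 < B)%N ->
  \sum_(e < A + B) (q ^ (e%:Z - A%:Z) * (zeta ^+ m * r i') ==
                    zeta ^- j * (zeta ^+ k * r i))%:R
  = ((i == i') && (zeta ^+ (m + j) == zeta ^+ k))%:R :> int.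
Proof.
move=> B0.
have ltA : (A < A + B)%N by rewrite -{1}[A]addn0 ltn_add2l.
have zX (e : nat) : zeta ^+ e != 0 by rewrite expf_neq0.
have [<-|neq] := eqVneq i i'; last first.
  rewrite big1 // => e _; case: eqP => // eqe; case: (r_indep neq).
  exists (j%:Z + m%:Z - k%:Z), (e%:Z - A%:Z).
  have -> : r i = zeta ^- k * (zeta ^+ j * (zeta ^- j * (zeta ^+ k * r i))).
    by rewrite (mulVKf (zX j)) (mulKf (zX k)).
  rewrite -eqe !(expfzDr _ _ zeta0) -exprnN -!exprnP; ring.
rewrite (bigD1 (Ordinal ltA)) //= subrr expr0z mul1r big1 => [|e neA].
  rewrite addr0 mulrA (inj_eq (mulIf (r0 i))); congr (_%:R).
  by rewrite -(inj_eq (mulfI (zX j))) (mulVKf (zX j)) -exprD addnC.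
case: eqP => // eqe; case/negP: neA; rewrite -val_eqE /=.
(* Raising the equality of roots to the power t eliminates [zeta] and leaves a power of q equal to
   1. *)
suff : (e%:Z - A%:Z) * t%:Z = 0.
  move/eqP; rewrite mulf_eq0 subr_eq0 orbC => /orP[|/eqP[->] //].
  by rewrite eqz_nat eqn0Ngt t_gt0.
apply: q_free; rewrite -exprz_exp -exprnP.
have : (q ^ (e%:Z - A%:Z) * zeta ^+ m) ^+ t = (zeta ^- j * zeta ^+ k) ^+ t.
  by congr (_ ^+ t); apply: (mulIf (r0 i)); rewrite -!mulrA.
rewrite !exprMn exprVn !(exprAC zeta _ t) zeta_t !expr1n.
by rewrite invr1 !mulr1.
Qed.

(** The orders of the product are summed over a window of the q-orbit of zeta^m r_i. By
    [window_match] this sum is the correlation at [m]; by telescoping it is 0. *)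
Lemma qcob_form_cycsum (n : 'I_t -> int) :
  qcob t q (\prod_(j < t) form j ^ n j) -> forall i (m : nat), cyc n i m = 0.
Proof.
move=> Hq i m.
have c0 : zeta ^+ m * r i != 0 by rewrite mulf_neq0 ?expf_neq0.
have [A [B [B0 <-]]] := qcob_window c0 Hq.
under [RHS]eq_bigr => e _ do rewrite ford_prod_form.
rewrite exchange_big /cycsum; apply: eq_bigr => j _.
rewrite -mulr_sumr.
under [in RHS]eq_bigr => e _.
  rewrite ford_form mulf_eq0 (negPf c0) orbF (negPf (expfz_neq0 _ q0)) mulr0 add0r.
  over.
rewrite exchange_big (bigD1 i) //= [X in _ + X]big1 => [|i' neq]; last first.
  rewrite exchange_big big1 // => k _; rewrite -mulr_sumr window_match //.
  by rewrite (negPf neq) mulr0.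
rewrite addr0 exchange_big mulr_sumr; apply: eq_bigr => k _.
rewrite -mulr_sumr window_match // eqxx /=; ring.
Qed.

(** The point 0 is fixed by z -> qz, so a coboundary has order 0 there, while only the factors z^T
    contribute to the order of the product. *)
Lemma qcob_form_ord0 (n : 'I_t -> int) :
  qcob t q (\prod_(j < t) form j ^ n j) -> T * \sum_(j < t) n j = 0.
Proof.
move=> /ford_qcob[b b0 /(_ 0)]; rewrite mulr0 subrr ford_prod_form => ord0.
rewrite -[RHS]ord0 mulr_sumr; apply: eq_bigr => j _; rewrite ford_form eqxx mulr1 mulrC.
rewrite big1 ?addr0 // => i _; rewrite big1 // => k _.
rewrite eq_sym !mulf_eq0 invr_eq0 (negPf (r0 i)) !expf_eq0 (negPf zeta0) !andbF.
by rewrite mulr0.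
Qed.

Lemma flead_form j : flead (form j) = lambda.
Proof.
have lead_lin c : flead (linfac c) = 1.
  by rewrite linfacE flead_tof lead_coefXsubC.
have leadX := big_morph _ (@fleadM C) (@flead1 C).
rewrite /rotated_form !fleadM flead_const fleadXz flead_tof lead_coefX exp1rz.
rewrite mulr1 leadX big1 ?mulr1 // => i _; rewrite leadX big1 // => k _.
by rewrite fleadXz lead_lin exp1rz.
Qed.

(** The linear factors are monic, so comparing leading coefficients gives a power of [lambda] equal
    to u times a power of q; the power t removes u. *)
Lemma qcob_form_lead (n : 'I_t -> int) :
  qcob t q (\prod_(j < t) form j ^ n j) ->
  exists m : int, lambda ^ ((\sum_(j < t) n j) * t%:Z) = q ^ m.
Proof.
move=> [b b0 [u ut /(congr1 (@flead C))]].
rewrite (big_morph _ (@fleadM C) (@flead1 C)).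
under eq_bigr => j _ do rewrite fleadXz flead_form.
rewrite -(big_morph _ (fun m n => expfzDr m n lambda0) (expr0z _)).
rewrite fleadM (fleadM (sigma q b)) flead_const fleadV.
have [m ->] := flead_sigma q0 b0.
rewrite mulfK ?flead_neq0 // => e; exists (m * t%:Z).
by rewrite -!exprz_exp e -!exprnP exprMn ut mul1r.
Qed.

(** When the linear factors are gathered by their root zeta^m r_i, the total exponent is the
    correlation at [m], so they all cancel. This is an equality, not merely a congruence. *)
Lemma form_congr (n : 'I_t -> int) : (forall i (m : 'I_t), cyc n i m = 0) ->
  \prod_(j < t) form j ^ n j = (tof lambda%:P * zvar C ^ T) ^ (\sum_(j < t) n j).
Proof.
move=> cyc0.
have base0 : tof lambda%:P * zvar C ^ T != 0.
  by apply: mulf_neq0; rewrite ?tofC_neq0 // expfz_neq0 // zvar_neq0.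
rewrite (big_morph _ (fun m n => expfzDr m n base0) (expr0z _)).
under [LHS]eq_bigr => j _ do rewrite /rotated_form expfzMl.
rewrite big_split /=; rewrite -[RHS]mulr1; congr (_ * _).
have expz_prod (I : finType) (F : I -> ratfun C) (m : int) :
    (\prod_i F i) ^ m = \prod_i F i ^ m.
  by apply: (big_morph (fun f => f ^ m)) => [f g|]; [apply: expfzMl | apply: exp1rz].
under eq_bigr => j _ do rewrite expz_prod.
rewrite exchange_big big1 // => i _.
pose L (m : nat) := linfac (zeta ^+ m * r i).
transitivity (\prod_(m < t) L m ^ cyc n i m); last first.
  by rewrite big1 // => m _; rewrite cyc0 expr0z.
have L0 m : L m != 0 by apply: linfac_neq0.
have LXD m := big_morph _ (fun k l => expfzDr k l (L0 m)) (expr0z (L m)).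
under [RHS]eq_bigr => m _ do rewrite /cycsum LXD.
rewrite [RHS]exchange_big; apply: eq_bigr => j _; rewrite expz_prod.
under [RHS]eq_bigr => m _ do rewrite LXD.
rewrite [RHS]exchange_big; apply: eq_bigr => k _.
have [m0 e eqm] := shift_index zeta_prim j k.
under [RHS]eq_bigr => m _ do rewrite eqm.
rewrite (bigD1 m0) //= eqxx mul1r big1 => [|m /negPf->]; last first.
  by rewrite mul0r expr0z.
by rewrite mulr1 exprz_exp /L e mulrA.
Qed.

End Criterion.

(** * Vanishing correlations and zero rows of D *)

Section ZeroRows.
Variables (C : numFieldType) (t N Rn : nat) (zeta : C).
Variable s : 'I_t -> int -> 'I_Rn -> int.
Hypothesis zeta_prim : t.-primitive_root zeta.
Local Notation cyc n i := (cycsum zeta (aik N s i) n).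

Let t_gt0 : (0 < t)%N := prim_order_gt0 zeta_prim.

(** A nonzero [n] has a nonzero Fourier coefficient at some -k, and the correlation theorem then
    kills row k in every column. For k = 0 that coefficient is the sum of the n_j. *)
Lemma zero_row_of_cycsum (n : 'I_t -> int) : (exists j, n j != 0) ->
  (forall i (m : 'I_t), cyc n i m = 0) ->
  exists2 k : 'I_t, zero_row (Dmat N zeta s) k & \sum_(j < t) n j = 0 -> (0 < k)%N.
Proof.
move=> [j0 nj0] cyc0; pose F (l : 'I_t) := \sum_(j < t) (n j)%:~R * (zeta ^- l) ^+ j.
have [k Fk0] : exists k, F k != 0.
  apply/existsP; apply: contraNT nj0 => /existsPn F0.
  rewrite -(intr_eq0 C) (dft_inj zeta_prim (n := n)) // => l.
  by apply/eqP; have := F0 l; rewrite negbK.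
exists k => [i|sum0].
  have /eqP := dft_cycsum zeta_prim k (cyc0 i).
  by rewrite mulf_eq0 -/(F k) (negPf Fk0) orbF mxE => /eqP.
rewrite lt0n; apply: contraNneq Fk0 => k0.
rewrite /F k0 expr0 invr1; under eq_bigr => j _ do rewrite expr1n mulr1.
by rewrite -rmorph_sum sum0.
Qed.

Lemma sum_prim_root (k : 'I_t) : (0 < k)%N -> \sum_(j < t) zeta ^+ (k * j) = 0.
Proof.
move=> k_gt0.
have zk : zeta ^+ k - 1 != 0.
  rewrite subr_eq0 -(expr0 zeta) (eq_prim_root_expr zeta_prim).
  by rewrite !modn_small ?ltn_ord // -lt0n.
under eq_bigr => j _ do rewrite exprM.
apply: (mulfI zk); rewrite -subrX1 exprAC (prim_expr_order zeta_prim).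
by rewrite expr1n subrr mulr0.
Qed.

(* The complex solution zeta ^+ (k * j) of the integral system yields an integral one. *)
Lemma cycsum_of_zero_row (k : 'I_t) : zero_row (Dmat N zeta s) k ->
  exists2 n : 'I_t -> int, exists j, n j != 0 &
    (forall i (m : 'I_t), cyc n i m = 0) /\ ((0 < k)%N -> \sum_(j < t) n j = 0).
Proof.
move=> Dk.
(* The equations [Some (i, m)] say that the correlations vanish; [None] says that the n_j sum to 0,
   and is void when k = 0. *)
pose A (j : 'I_t) (c : option ('I_Rn * 'I_t)) : int :=
  if c is Some (i, m)
  then \sum_(l < t) (zeta ^+ (m + j) == zeta ^+ l)%:R * aik N s i l
  else (0 < k)%N%:R.
have [||n n0 nA] := @int_kernel C t _ A (fun j => zeta ^+ (k * j)).
- exists (Ordinal t_gt0); apply: expf_neq0.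
  exact: (root1_neq0 t_gt0 (prim_expr_order zeta_prim)).
- case=> [[i m]|] /=.
    by rewrite dft_shift //; have := Dk i; rewrite mxE => ->; rewrite mulr0.
  rewrite -mulr_suml; have [->|k_gt0] := posnP k; first by rewrite mulr0.
  by rewrite sum_prim_root // mul0r.
exists n => //; split=> [i m|k_gt0].
  rewrite -[RHS](nA (Some (i, m))) /cycsum; apply: eq_bigr => j _ /=.
  by rewrite mulr_sumr; apply: eq_bigr => l _; ring.
by rewrite -[RHS](nA None) /= k_gt0; apply: eq_bigr => j _; rewrite mulr1.
Qed.

End ZeroRows.

(** * From coboundaries up to roots of unity to exact solutions *)

Section Solvability.
Variables (C : fieldType) (t : nat) (zeta q : C).
Hypotheses (q0 : q != 0) (t_gt0 : (0 < t)%N).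

(** Raising to the power t removes the constant [u]; the exponents become n_j L t, and [b] becomes
    b^t. *)
Lemma q_solvable_qcob (a : ratfun C) (n : 'I_t -> int) (L : int) :
  (exists j, n j != 0) -> L != 0 -> qcob t q (phi zeta n a ^ L) ->
  q_solvable t zeta q a.
Proof.
move=> [j nj] L0 [b b0 [u ut e]].
exists (b ^ t%:Z), (fun j => n j * L * t%:Z); split; first exact: expfz_neq0.
split; first by exists j; rewrite !mulf_neq0 // eqz_nat -lt0n.
have phiX (m : 'I_t -> int) (l : int) :
      phi zeta (fun j => m j * l) a = phi zeta m a ^ l.
  rewrite /phi; under eq_bigr => i _ do rewrite -exprz_exp.
  apply: esym; apply: (big_morph (fun f => f ^ l)) => [f g|]; last exact: exp1rz.
  exact: expfzMl.
rewrite (phiX (fun j => n j * L)) phiX e expfzMl -exprnP -tofracXn -polyC_exp ut.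
by rewrite tofrac1 mul1r expfzMl (sigmaXz _ _ q0) exprz_inv invr_expz.
Qed.

End Solvability.

(** * The two cases of the theorem *)

Lemma exprz_eq1_norm (C : numFieldType) (q : C) (m : int) :
  1 < `|q| -> q ^ m = 1 -> m = 0.
Proof.
move=> q1; have nat_case (k : nat) : q ^+ k = 1 -> k = 0%N.
  move=> /(congr1 Num.norm)/eqP; rewrite normrX normr1.
  by rewrite pexprn_eq1 ?normr_ge0 // (gt_eqF q1) orbF => /eqP.
case: m => k; first by rewrite -exprnP => /nat_case ->.
by rewrite NegzE -exprnN -[X in _ = X]invr1 => /invr_inj/nat_case.
Qed.

Theorem theorem7 (R : realType) (q zeta lambda : R[i]) (t N Rn : nat) (T : int)
  (r : 'I_Rn -> R[i]) (s : 'I_t -> int -> 'I_Rn -> int) (a : ratfun R[i]) :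
  1 < `|q| ->
  (2 <= t)%N ->
  t.-primitive_root zeta ->
  lambda != 0 ->
  (forall i, r i != 0) ->
  (forall i j : 'I_Rn, i != j ->
     ~ exists m n : int, r i = zeta ^ m * q ^ n * r j) ->
  a = prod_form N zeta q lambda T r s ->
  ((T = 0 /\
    ((exists m n : int, lambda ^ m = q ^ n /\ q ^ n != 1) \/
     (exists n : nat, (0 < n)%N /\ lambda ^+ n = 1))) ->
   (q_solvable t zeta q a <-> exists k, zero_row (Dmat N zeta s) k))
  /\
  ((T != 0 \/
    ((~ exists m n : int, lambda ^ m = q ^ n /\ q ^ n != 1) /\
     (~ exists n : nat, (0 < n)%N /\ lambda ^+ n = 1))) ->
   (q_solvable t zeta q a <->
      exists k : 'I_t, (0 < k)%N /\ zero_row (Dmat N zeta s) k)).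

Proof.
move=> q1 _ zeta_prim lambda0 r0 r_indep ->.
have q0 : q != 0 by rewrite -normr_gt0 (lt_trans ltr01).
have q_free m := exprz_eq1_norm (m := m) q1.
have t_gt0 := prim_order_gt0 zeta_prim.
have zeta_t := prim_expr_order zeta_prim.
have cphi := cong_phi q0 t_gt0 zeta_t N lambda T r s.
have necessity : q_solvable t zeta q (prod_form N zeta q lambda T r s) ->
    exists n : 'I_t -> int, [/\ exists j, n j != 0,
      forall i (m : 'I_t), cycsum zeta (aik N s i) n m = 0,
      T * \sum_(j < t) n j = 0 &
      exists m : int, lambda ^ ((\sum_(j < t) n j) * t%:Z) = q ^ m].
  move=> [b [n [b0 [n0 phiE]]]]; exists n.
  have Hq : qcob t q (\prod_(j < t) rotated_form zeta N lambda T r s j ^ n j).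
    have [h Hh ->] := cong_sym q0 t_gt0 (cphi n).
    apply: (qcobM q0) Hh; rewrite phiE; exact: qcob_sigma.
  split=> // [i m||].
  - exact: (qcob_form_cycsum zeta_prim q0 q_free lambda0 r0 r_indep Hq).
  - exact: (qcob_form_ord0 zeta_prim q0 lambda0 r0 Hq).
  - exact: (qcob_form_lead q0 lambda0 Hq).
(* With the linear factors cancelled, it remains to make a power of lambda z^T a power of q, which
   is a coboundary. *)
have sufficiency (n : 'I_t -> int) (L m : int) : (exists j, n j != 0) ->
    (forall i (m : 'I_t), cycsum zeta (aik N s i) n m = 0) -> L != 0 ->
    (tof lambda%:P * zvar _ ^ T) ^ ((\sum_(j < t) n j) * L) = tof q%:P ^ m ->
    q_solvable t zeta q (prod_form N zeta q lambda T r s).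
  move=> n0 cyc0 L0 e; apply: (q_solvable_qcob q0 t_gt0 n0 L0).
  have [h Hh ->] := congXz q0 t_gt0 L (cphi n).
  rewrite (form_congr _ _ zeta_prim lambda0 cyc0) exprz_exp e.
  by apply: (qcobM q0) Hh; apply: (qcobXz q0 t_gt0); apply: qcob_q.
split=> [[T0 lambda_q]|lambda_q]; split.
- move/necessity=> [n [n0 cyc0 _ _]].
  by have [k Dk _] := zero_row_of_cycsum zeta_prim n0 cyc0; exists k.
- move=> [k Dk]; have [n n0 [cyc0 _]] := cycsum_of_zero_row zeta_prim Dk.
  (* Both alternatives give such a relation: m = 0 for a root of unity, and otherwise L = 0 would
     force q^m = 1. *)
  have [L [m [L0 e]]] : exists L m : int, L != 0 /\ lambda ^ L = q ^ m.
    case: lambda_q => [[L [m [e qm1]]]|[L [L_gt0 e]]]; last first.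
      by exists L, 0; rewrite expr0z -exprnP e eqz_nat -lt0n.
    exists L, m; split=> //; apply: contraNneq qm1 => L0.
    by rewrite -e L0 expr0z.
  have tofXz c (l : int) : tof c%:P ^ l = tof (c ^ l)%:P :> ratfun R[i].
    exact: (esym (fmorphXz (@FracField.tofrac _ \o polyC) l c)).
  apply: (sufficiency n L (m * \sum_(j < t) n j)) => //.
  by rewrite T0 expr0z mulr1 mulrC -!exprz_exp !tofXz e.
- move/necessity=> [n [n0 cyc0 ord0 [m lead]]].
  have [k Dk k_gt0] := zero_row_of_cycsum zeta_prim n0 cyc0.
  exists k; split=> //; apply: k_gt0; apply/eqP.
  set S := \sum_(j < t) n j in ord0 lead *.
  (* The sum S vanishes by the order at 0 if T is nonzero. Otherwise the relation on leading
     coefficients must be trivial, and a nonzero S would make [lambda] a root of unity. *)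
  case: lambda_q => [T0|[no_q no_root]].
    by move/eqP: ord0; rewrite mulf_eq0 (negPf T0).
  have qm1 : q ^ m = 1.
    by apply/eqP/negPn/negP => qm1; case: no_q; exists (S * t%:Z), m.
  apply/negPn/negP => S0; case: no_root; exists (absz S * t)%N.
  rewrite muln_gt0 absz_gt0 S0 t_gt0; split=> //.
  move: lead; rewrite qm1 exprM -exprz_exp -exprnP; case: (S) => // l.
  by rewrite NegzE -exprnN exprVn -[X in _ = X]invr1 => /invr_inj.
- move=> [k [k_gt0 Dk]].
  have [n n0 [cyc0 /(_ k_gt0) S0]] := cycsum_of_zero_row zeta_prim Dk.
  (* Since the n_j sum to 0, lambda z^T disappears whatever [lambda] and T are. *)
  by apply: (sufficiency n 1 0) => //; rewrite S0 mul0r !expr0z.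
Qed.
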